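(* Let $d$ be an integer with $d\notin\{1,-1,2,-2\}$. Then the negative polynomial Pell equation $$P^2(X)-(X^2+d)\,Q^2(X)=-1$$ has no non-trivial solutions $P(X),Q(X)$ with coefficients in the Gaussian integers $\mathbb{Z}[i]$.
   Context: A solution is a pair of polynomials $P(X),Q(X)\in\mathbb{Z}[i][X]$ satisfying the equation identically. It is called non-trivial if $Q(X)\neq 0$ (equivalently, $P(X)$ is non-constant); the trivial solutions are $P=\pm i$, $Q=0$. *)

(* Defs.v *)
From mathcomp Require Import all_boot all_order all_algebra all_field.

Set Implicit Arguments.
Unset Strict Implicit.
Unset Printing Implicit Defensive.

Import Order.TTheory GRing.Theory Num.Theory.

Local Open Scope ring_scope.

(* The ring Z[i], as a predicate on algC; Z[i][X] is then rendered as the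
   polynomials P : {poly algC} with P \is a polyOver gaussInt. *)
Definition gaussInt : {pred algC} :=
  [pred z : algC | ('Re z \is a Num.int) && ('Im z \is a Num.int)].

Definition neg_pell_solution (d : int) (P Q : {poly algC}) : Prop :=
  [/\ P \is a polyOver gaussInt,
      Q \is a polyOver gaussInt
    & P ^+ 2 - ('X^2 + (d%:~R)%:P) * Q ^+ 2 = -1].

(* The remaining solutions, those with Q = 0, are P = 'i%:P and P = - 'i%:P. *)
Definition nontrivial_neg_pell_solution (d : int) (P Q : {poly algC}) : Prop :=
  neg_pell_solution d P Q /\ Q <> 0.

(* Main.v *)
Require Import Defs.
From mathcomp Require Import all_boot all_order all_algebra all_field.
From mathcomp Require Import ring zify.

Import Order.TTheory GRing.Theory Num.Theory.

Local Open Scope ring_scope.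

(** Over a field, a solution of [P^2 - (X^2 + d) Q^2 = k] with [Q <> 0] and
    leading coefficients of [P] and [Q] equal can be multiplied by
    [X - sqrt (X^2 + d)], of norm [-d]; this lowers the degree of [P] by one and
    multiplies its leading coefficient [l] by [- d / 2] (by [- d] at the last
    step). Descending to a constant gives [l^2 (-d)^n = k 4^(n-1)] with
    [n = deg P]. For [k = -1] and [l] a Gaussian integer, taking norms shows
    that [|d|^n] divides [4^(n-1)], hence [|d|] is 1 or 2. *)


Section PellDescent.

Variables (F : fieldType) (d : F).
Implicit Types (P Q : {poly F}) (k : F).

Let D : {poly F} := 'X^2 + d%:P.

Lemma size_quadratic : size D = 3.
Proof.
by rewrite size_polyDl size_polyXn // (leq_ltn_trans (size_polyC_leq1 _)).
Qed.

Lemma lead_coef_quadratic : lead_coef D = 1.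
Proof.
rewrite lead_coefDl ?lead_coefXn // size_polyXn.
exact: leq_ltn_trans (size_polyC_leq1 _) _.
Qed.

Lemma quadratic_neq0 : D != 0.
Proof. by rewrite -size_poly_eq0 size_quadratic. Qed.

Lemma size_quadratic_mul Q : Q != 0 -> size (D * Q) = (size Q).+2.
Proof. by move=> Q0; rewrite size_mul ?quadratic_neq0 // size_quadratic. Qed.

Lemma lead_coef_quadratic_mul Q : lead_coef (D * Q) = lead_coef Q.
Proof. by rewrite lead_coefM lead_coef_quadratic mul1r. Qed.

(** As [D] is monic of degree 2 and [Q] is nonzero, [D * Q ^+ 2] dominates the constant [k], so it
    shares its degree and leading coefficient with [P ^+ 2]. *)
Lemma pell_size_lead k P Q :
    Q != 0 -> P ^+ 2 - D * Q ^+ 2 = k%:P ->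
  size P = (size Q).+1 /\ lead_coef P ^+ 2 = lead_coef Q ^+ 2.
Proof.
move=> Q0 /(canRL (subrK _)); rewrite addrC => EP.
have sM : size (D * Q ^+ 2) = (size Q + size Q).+1.
  rewrite size_quadratic_mul ?expf_neq0 // expr2 size_mul //.
  by move: Q0; rewrite -size_poly_gt0; case: (size Q).
have sk : (size k%:P < size (D * Q ^+ 2)%R)%N.
  rewrite sM (leq_ltn_trans (size_polyC_leq1 _)) // ltnS addn_gt0.
  by rewrite size_poly_gt0 Q0.
have P0 : P != 0.
  apply: contraTneq sk => P0; rewrite -leqNgt -(size_polyN k%:P).
  by move: EP; rewrite P0 expr0n /= => /esym/eqP; rewrite addr_eq0 => /eqP ->.
split.
  have := congr1 (fun p : {poly F} => size p) EP.
  rewrite /= size_polyDl // sM expr2 size_mul //; move: (size P) (size Q); lia.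
rewrite -lead_coef_exp EP lead_coefDl // lead_coef_quadratic_mul.
exact: lead_coef_exp.
Qed.

(* The product of [X P - D Q] with its conjugate [X P + D Q], of degree
   [deg P + 1], is [k X^2 - d D Q^2], of degree at most [2 deg P]. *)
Lemma pell_descent_size k P Q :
    2%:R != 0 :> F -> Q != 0 -> P ^+ 2 - D * Q ^+ 2 = k%:P ->
    lead_coef P = lead_coef Q ->
  (size ('X * P - D * Q)%R < size P)%N.
Proof.
move=> two0 Q0 EP lPQ; have [sP _] := pell_size_lead k P Q Q0 EP.
have P0 : P != 0 by rewrite -size_poly_eq0 sP.
have sXP : size ('X * P) = (size P).+1 by rewrite mulrC size_mulX.
have sDQ : size (D * Q) = (size P).+1 by rewrite size_quadratic_mul // sP.
have s2 : size ('X * P + D * Q) = (size P).+1.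
  apply/eqP; rewrite eqn_leq; apply/andP; split.
    by rewrite (leq_trans (size_polyD _ _)) // sXP sDQ maxnn.
  (* The two top coefficients agree, so they add up to twice [lead_coef P] instead of cancelling. *)
  have : ('X * P + D * Q)`_(size P) != 0.
    rewrite coefD.
    have -> : ('X * P)`_(size P) = lead_coef P.
      by rewrite -[X in nth _ _ X]/((size P).+1.-1) -sXP -lead_coefE
        lead_coefM lead_coefX mul1r.
    have -> : (D * Q)`_(size P) = lead_coef P.
      by rewrite -[X in nth _ _ X]/((size P).+1.-1) -sDQ -lead_coefE
        lead_coef_quadratic_mul lPQ.
    by rewrite -mulr2n -mulr_natr mulf_neq0 ?lead_coef_eq0.
  by apply: contraR; rewrite -leqNgt => ?; rewrite nth_default.
have [->|P1] := eqVneq ('X * P - D * Q) 0.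
  by rewrite size_poly0 size_poly_gt0.
have E : ('X * P - D * Q) * ('X * P + D * Q) = k *: 'X^2 - d *: (D * Q ^+ 2).
  have -> : k *: 'X^2 = (P ^+ 2 - D * Q ^+ 2) * 'X^2 by rewrite EP mul_polyC.
  by rewrite -mul_polyC /D; ring.
have := congr1 (fun p : {poly F} => size p) E.
have P2 : 'X * P + D * Q != 0 by rewrite -size_poly_eq0 s2.
rewrite /= size_mul // s2 => E2.
have : (size (k *: 'X^2 - d *: (D * Q ^+ 2))%R <= (size Q + size Q).+1)%N.
  have sQ : (0 < size Q)%N by rewrite size_poly_gt0.
  rewrite (leq_trans (size_polyD _ _)) // size_polyN geq_max; apply/andP; split.
    rewrite (leq_trans (size_scale_leq _ _)) // size_polyXn.
    by move: sQ; case: (size Q) => // q _; rewrite addSn addnS.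
  rewrite (leq_trans (size_scale_leq _ _)) //.
  rewrite size_quadratic_mul ?expf_neq0 // expr2 size_mul //.
  by move: sQ; case: (size Q).
rewrite -E2 sP; move: (size _) (size Q); lia.
Qed.

(** Here [n.+1] is the degree of [P]. The constant [k] is arbitrary because each descent step
    replaces it by [- d * k]. *)
Lemma pell_lead_coef k n P Q :
    2%:R != 0 :> F -> d != 0 -> size P = n.+2 ->
    P ^+ 2 - D * Q ^+ 2 = k%:P ->
  lead_coef P ^+ 2 * (- d) ^+ n.+1 = k * 4%:R ^+ n.
Proof.
move=> two0 d0; elim/ltn_ind: n k P Q => n IHn k P Q sP EP.
have Q0 : Q != 0.
  apply/eqP => Q0; move: EP; rewrite Q0 expr0n mulr0 subr0 => EP.
  have := size_polyC_leq1 k.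
  have P0 : P != 0 by rewrite -size_poly_eq0 sP.
  by rewrite -EP expr2 size_mul // sP addSn addnS.
wlog lPQ : Q EP Q0 / lead_coef P = lead_coef Q => [Hw|].
  have [_ /eqP] := pell_size_lead k P Q Q0 EP.
  rewrite eqf_sqr => /orP [] /eqP lPQ; first exact: (Hw Q).
  by apply: (Hw (- Q)); rewrite ?sqrrN ?oppr_eq0 ?lead_coefN.
have := pell_descent_size k P Q two0 Q0 EP lPQ; rewrite sP ltnS.
(* With [s] a square root of [D], [P1 + Q1 s] is [(P + Q s) (X - s)]; multiplying back by [X + s]
   gives [dP] below. *)
pose P1 := 'X * P - D * Q; pose Q1 := 'X * Q - P; rewrite -/P1 => sP1.
have EP1 : P1 ^+ 2 - D * Q1 ^+ 2 = (- d * k)%:P.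
  by rewrite polyCM -EP polyCN /P1 /Q1 /D; ring.
have dP : (- d) *: P = 'X * P1 + D * Q1.
  by rewrite -mul_polyC polyCN /P1 /Q1 /D; ring.
have nd0 : - d != 0 by rewrite oppr_eq0.
have sdP : size ((- d) *: P) = n.+2 by rewrite size_scale.
have ldP : lead_coef ((- d) *: P) = - d * lead_coef P by rewrite lead_coefZ.
(* Last step of the descent: [P1 ^+ 2] is constant, which forces [n = 0]. *)
have [Q10|Q10] := eqVneq Q1 0.
  have P10 : P1 != 0.
    by apply/eqP => P10; move: sdP; rewrite dP P10 Q10 !mulr0 addr0 size_poly0.
  have sn : size P1 = n.+1.
    by apply: succn_inj; rewrite -sdP dP Q10 mulr0 addr0 mulrC size_mulX.
  move: EP1; rewrite Q10 expr0n mulr0 subr0 => EP1.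
  have n0 : n = 0%N.
    have := size_polyC_leq1 (- d * k).
    by rewrite -EP1 expr2 size_mul // sn; case: (n) => // j; rewrite addSn addnS.
  have lP1 : lead_coef P1 = - d * lead_coef P.
    by rewrite -ldP dP Q10 mulr0 addr0 lead_coefM lead_coefX mul1r.
  have := congr1 (fun p : {poly F} => lead_coef p) EP1.
  rewrite /= lead_coef_exp lP1 lead_coefC n0 expr0 expr1 mulr1 => E.
  by apply: (mulfI nd0); rewrite -E; ring.
have [sP1Q1 l2] := pell_size_lead _ P1 Q1 Q10 EP1.
have sQ1 : (0 < size Q1)%N by rewrite size_poly_gt0.
have P10 : P1 != 0 by rewrite -size_poly_eq0 sP1Q1.
have sXP : size ('X * P1) = (size P1).+1 by rewrite mulrC size_mulX.
have sDQ : size (D * Q1) = (size P1).+1 by rewrite size_quadratic_mul // sP1Q1.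
have sn : size P1 = n.+1.
  apply/eqP; rewrite eqn_leq sP1 -ltnS -sdP dP.
  by rewrite (leq_trans (size_polyD _ _)) // sXP sDQ maxnn.
have ldP2 : - d * lead_coef P = lead_coef P1 + lead_coef Q1.
  rewrite -ldP lead_coefE sdP dP coefD /=.
  rewrite -[X in nth 0 ('X * P1) X]/(n.+2.-1) -[X in nth 0 (D * Q1) X]/(n.+2.-1).
  by rewrite -{1}sn -sXP -sn -sDQ -!lead_coefE lead_coef_quadratic_mul
    lead_coefM lead_coefX mul1r.
have lP0 : - d * lead_coef P != 0.
  by rewrite mulf_neq0 // lead_coef_eq0 -size_poly_eq0 sP.
(* Opposite signs would cancel the leading coefficient of [(- d) *: P]. Hence [- d * lead_coef P] is
   twice [lead_coef P1]. *)
have lP1Q1 : lead_coef Q1 = lead_coef P1.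
  move/eqP: l2; rewrite eqf_sqr => /orP [] /eqP // lN.
  by move: lP0; rewrite ldP2 lN addNr eqxx.
(* For [n = 0], [P1] would be constant, but [Q1 != 0] gives it positive degree. *)
case: n IHn sP sP1 sdP sn => [|n] IHn sP sP1 sdP sn.
  by move: sQ1; rewrite -ltnS -sP1Q1 sn.
have := IHn n (ltnSn n) _ P1 Q1 sn EP1.
rewrite lP1Q1 in ldP2 => IH.
apply: (mulfI nd0).
have -> : - d * (k * 4%:R ^+ n.+1) = 4%:R * (- d * k * 4%:R ^+ n).
  by rewrite exprS; ring.
rewrite -IH.
have -> : 4%:R * (lead_coef P1 ^+ 2 * (- d) ^+ n.+1)
   = (lead_coef P1 + lead_coef P1) ^+ 2 * (- d) ^+ n.+1 by ring.
by rewrite -ldP2 [(- d) ^+ n.+2]exprS; ring.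
Qed.

End PellDescent.

Lemma gaussInt_sqr_norm (z : algC) : z \in gaussInt ->
  exists m : nat, `|z| ^+ 2 = m%:R.
Proof.
case/andP => zR zI; rewrite normC2_Re_Im.
by exists (Num.truncn ('Re z ^+ 2 + 'Im z ^+ 2)); rewrite truncnK // rpredD //
  natr_exp_even.
Qed.

(** Such an [e] divides a power of 2, so [e = 2 ^ j]; then [j * (n + 1) <= 2 * n] forces [j < 2]. *)
Lemma dvdn_exp_pow4 (e n : nat) : (e ^ n.+1 %| 4 ^ n -> e \in [:: 1; 2])%N.
Proof.
move=> dv; have pr2 : prime 2 by [].
have : (e %| 2 ^ (2 * n))%N.
  by rewrite expnM (dvdn_trans _ dv) // expnS dvdn_mulr.
case/(dvdn_pfactor _ _ pr2) => j _ ej; move: dv.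
rewrite ej -expnM -(expnM 2 2) dvdn_Pexp2l //.
case: j {ej} => [|[|j]] //; nia.
Qed.

Theorem theorem1p1 (d : int) (hd : d \notin [:: 1; -1; 2; -2]) :
  ~ exists P Q : {poly algC}, nontrivial_neg_pell_solution d P Q.
Proof.
case=> P [Q [[PG _ EP] /eqP Q0]].
have EP' : P ^+ 2 - ('X^2 + (d%:~R)%:P) * Q ^+ 2 = (-1)%:P by rewrite EP polyCN.
have [sPQ _] := pell_size_lead _ _ _ _ _ Q0 EP'.
(* The descent needs [d] nonzero. For [d = 0] the left side factors over the polynomials; both
   factors are constants, yet their difference [2 X Q] is not. *)
have [d0|d0] := eqVneq d 0.
  have E : (P - 'X * Q) * (P + 'X * Q) = (-1)%:P.
    by rewrite -EP' d0 addr0; ring.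
  have /andP [A0 B0] : (P - 'X * Q != 0) && (P + 'X * Q != 0).
    by rewrite -negb_or -mulf_eq0 E polyC_eq0 oppr_eq0 oner_eq0.
  have := congr1 (fun p : {poly algC} => size p) E.
  rewrite /= size_mul // size_polyC oppr_eq0 oner_eq0 /= => sE.
  have : (size ((P + 'X * Q) - (P - 'X * Q))%R <= 1)%N.
    rewrite (leq_trans (size_polyD _ _)) // size_polyN geq_max.
    move: sE A0 B0; rewrite -!size_poly_gt0; move: (size _) (size _); lia.
  have -> : (P + 'X * Q) - (P - 'X * Q) = 2%:R *: (Q * 'X).
    by rewrite scaler_nat; ring.
  rewrite size_scale ?pnatr_eq0 // size_mulX // ltnS leqn0 size_poly_eq0.
  by rewrite (negPf Q0).
have [n sP] : exists n, size P = n.+2.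
  by exists (size Q).-1; rewrite sPQ prednK // size_poly_gt0.
have dC0 : d%:~R != 0 :> algC by rewrite intr_eq0.
have two0 : 2%:R != 0 :> algC by rewrite pnatr_eq0.
have E := pell_lead_coef _ _ _ n P Q two0 dC0 sP EP'.
have [m Em] : exists m : nat, `|lead_coef P| ^+ 2 = m%:R.
  by apply: gaussInt_sqr_norm; apply: (allP PG);
    rewrite lead_coefE mem_nth // sP.
(* Absolute values in [E] remove the signs of [-1] and [- d], leaving an identity between natural
   numbers. *)
have : (m * `|d| ^ n.+1)%N = (4 ^ n)%N.
  apply/eqP; rewrite -(eqr_nat algC) natrM !natrX -Em natr_absz intr_norm.
  rewrite -[`|d%:~R|]normrN -!normrX -normrM E.
  by rewrite normrM normrN normr1 mul1r normrX normr_nat.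
move=> /esym dv; have /dvdn_exp_pow4 : (`|d| ^ n.+1 %| 4 ^ n)%N.
  by rewrite dv dvdn_mull.
move: hd; rewrite !inE; lia.
Qed.
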